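(* Let $G=(V,E)$ be a finite directed graph, $k$ an integer with $1\le k\le |V|$, and $\Theta=\times_{e\in E}[l_e,r_e]$ a parameter space with $0\le l_e\le r_e\le 1$ for every $e\in E$. Then the Lower-Upper Greedy algorithm (LUGreedy) on input $(G,k,\Theta)$ outputs a seed set $S^{\mathrm{LU}}_\Theta$ of size $k$ such that $$g(\Theta,S^{\mathrm{LU}}_\Theta)\;\ge\;\alpha(\Theta)\left(1-\frac1e\right),\qquad\text{where}\qquad \alpha(\Theta):=\frac{\sigma_{\theta^-}(S^{\mathrm{LU}}_\Theta)}{\sigma_{\theta^+}(S^{g}_{\theta^+})}.$$
   Context: Independent cascade model. Given a directed graph $G=(V,E)$ and a parameter vector $\theta=(p_e)_{e\in E}\in[0,1]^E$, a random live-edge graph $L$ is the subgraph on $V$ containing each edge $e\in E$ independently with probability $p_e$. For $S\subseteq V$, $R_L(S)$ is the set of nodes reachable from $S$ by directed paths in $L$ (including $S$ itself). The influence spread is $\sigma_\theta(S)=\sum_L \Pr_\theta[L]\,|R_L(S)|$, i.e. the expected value of $|R_L(S)|$. For a budget $k$, $S^*_\theta$ denotes a set maximizing $\sigma_\theta(S)$ over $S\subseteq V$ with $|S|=k$. For a parameter space $\Theta=\times_{e\in E}[l_e,r_e]$, let $\theta^-=(l_e)_{e\in E}$ and $\theta^+=(r_e)_{e\in E}$. The robust ratio of a set $S\subseteq V$ with $|S|=k$ is $$g(\Theta,S)=\min_{\theta\in\Theta}\frac{\sigma_\theta(S)}{\sigma_\theta(S^*_\theta)}.$$ Greedy: $S^g_\theta$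 denotes the output $S_k$ of the greedy algorithm that starts with $S_0=\emptyset$ and, for $i=1,\dots,k$, chooses $v\in\arg\max_{v\notin S_{i-1}}\{\sigma_\theta(S_{i-1}\cup\{v\})-\sigma_\theta(S_{i-1})\}$ and sets $S_i=S_{i-1}\cup\{v\}$ (with exact evaluation of $\sigma_\theta$ and arbitrary tie-breaking). LUGreedy: on input $(G,k,\Theta)$, compute $S^g_{\theta^-}$ and $S^g_{\theta^+}$ and output $S^{\mathrm{LU}}_\Theta\in\arg\max_{S\in\{S^g_{\theta^-},\,S^g_{\theta^+}\}}\sigma_{\theta^-}(S)$. In the definition of $\alpha(\Theta)$, $S^g_{\theta^+}$ is the same set as the one computed by LUGreedy. *)

(* Defs.v *)
From HB Require Import structures.
From mathcomp Require Import all_boot all_order all_algebra.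
From mathcomp Require Import all_classical all_reals all_analysis.

Set Implicit Arguments.
Unset Strict Implicit.
Unset Printing Implicit Defensive.

Import Order.TTheory GRing.Theory Num.Theory.
Import numFieldNormedType.Exports.

Local Open Scope ring_scope.

(* A directed graph on V is given by its edge set E : {set V * V}.  A parameter
   vector is a function theta : V * V -> R of which only the restriction to E
   is ever used. *)
Section InfluenceSpread.
Variables (R : realType) (V : finType) (E : {set V * V}).
Implicit Types (theta l r : V * V -> R) (S : {set V}) (L : {set V * V}).

(* Each edge of E is live independently, with probability theta e. *)
Definition live_prob theta L : R :=
  \prod_(e in E) (if e \in L then theta e else 1 - theta e).

Definition reach L S : {set V} :=
  [set v | [exists u in S, connect (fun x y => (x, y) \in L) u v]]%SET.

Definition spread theta S : R :=
  \sum_(L : {set V * V} | L \subset E) live_prob theta L * #|reach L S|%:R.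

Definition optimal_seed (k : nat) theta S : Prop :=
  #|S| = k /\ forall T : {set V}, #|T| = k -> spread theta T <= spread theta S.

Definition param_space l r : set (V * V -> R) :=
  [set theta | forall e, e \in E -> l e <= theta e <= r e]%classic.

(* The value of the ratio does not depend on which optimal seed set is taken,
   since all of them have the same spread. *)
Definition ratios (k : nat) l r S : set R :=
  [set x | exists theta Sopt, [/\ param_space l r theta,
     optimal_seed k theta Sopt & x = spread theta S / spread theta Sopt]]%classic.

(* This infimum is a minimum, see [robust_ratio_min] below. *)
Definition robust_ratio (k : nat) l r S : R := inf (ratios k l r S).

(* [greedy theta i S]: some run of the greedy algorithm, under some way of
   breaking ties, reaches S after i steps. *)
Inductive greedy theta : nat -> {set V} -> Prop :=
| greedy_start : greedy theta 0 finset.set0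
| greedy_step i S v : greedy theta i S -> v \notin S ->
    (forall w, w \notin S -> spread theta (w |: S) - spread theta S
                             <= spread theta (v |: S) - spread theta S) ->
    greedy theta i.+1 (v |: S).

(* [lu_greedy k l r Sm Sp S]: some run of LUGreedy computes Sm as the greedy set
   for l, Sp as the greedy set for r, and outputs S. *)
Definition lu_greedy (k : nat) l r (Sm Sp S : {set V}) : Prop :=
  [/\ greedy l k Sm, greedy r k Sp, S = Sm \/ S = Sp
    & spread l Sm <= spread l S /\ spread l Sp <= spread l S].

Definition alpha l r (S Sp : {set V}) : R := spread l S / spread r Sp.

End InfluenceSpread.

Section RobustRatioMin.
Variables (R : realType) (V : finType) (E : {set V * V}).
Implicit Types (theta l r : V * V -> R) (S T : {set V}) (L : {set V * V}).

Definition is_param theta := forall e, e \in E -> 0 <= theta e <= 1.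

Lemma live_prob_ge0 theta L : is_param theta -> 0 <= live_prob E theta L.
Proof.
move=> h; apply: prodr_ge0 => e /h /andP[h0 h1].
by case: ifP => _ //; rewrite subr_ge0.
Qed.

Lemma sum_live_prob theta : \sum_(L : {set V * V} | L \subset E) live_prob E theta L = 1.
Proof.
pose F e := if e \in E then theta e else 0.
pose G e := if e \in E then 1 - theta e else 1.
have FG : \prod_e (F e + G e) = 1.
  apply: big1 => e _; rewrite /F /G; case: ifP => _; last by rewrite add0r.
  by rewrite addrC subrK.
rewrite -FG (bigA_distr _ _ F G) [RHS](bigID (fun L : {set V * V} => L \subset E)) /=.
rewrite [X in _ + X]big1 ?addr0 => [|L].
  apply: eq_bigr => L LE; rewrite /live_prob big_mkcond; apply: eq_bigr => e _.
  rewrite /F /G; case: (boolP (e \in E)) => eE //.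
  by case: ifP => // /(fintype.subsetP LE); rewrite (negPf eE).
case/fintype.subsetPn => e eL eE; rewrite (bigD1 e) //= eL /F (negPf eE).
by rewrite mul0r.
Qed.

Lemma spread_ge_card theta S : is_param theta -> #|S|%:R <= spread E theta S.
Proof.
move=> h; rewrite -[leLHS]mul1r -[X in X * _ <= _](sum_live_prob theta) big_distrl /=.
apply: ler_sum => L _; apply: ler_wpM2l; first exact: live_prob_ge0.
rewrite ler_nat; apply/subset_leq_card/fintype.subsetP => v vS.
by rewrite inE; apply/existsP; exists v; rewrite vS connect0.
Qed.

Lemma optimal_seed_exists theta k : (k <= #|V|)%N ->
  exists S, optimal_seed E k theta S.
Proof.
move=> kV; pose S0 : {set V} := [set:: take k (enum V)]%SET.
have S0k : #|S0| == k.
  rewrite cardsE (card_uniqP _) ?take_uniq ?enum_uniq //.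
  by rewrite size_takel // -cardE.
case: (@arg_maxP _ _ _ S0 (fun S : {set V} => #|S| == k) (spread E theta) S0k).
move=> S /eqP Sk Smax; exists S; split => // T /eqP Tk; exact: Smax.
Qed.

Lemma spread_ext theta theta' S : {in E, theta =1 theta'} ->
  spread E theta S = spread E theta' S.
Proof.
move=> h; apply: eq_bigr => L _; congr (_ * _).
by apply: eq_bigr => e eE; rewrite h.
Qed.

Lemma spread_continuous (X : topologicalType) (p : X -> V * V -> R) S :
  (forall e, continuous (p^~ e)) -> continuous (fun x => spread E (p x) S).
Proof.
move=> cp.
have cprob L : continuous (fun x => live_prob E (p x) L).
  apply: (@continuous_big R _ *%R 1 (fun e => e \in E) _ X) => [|e _].
    exact: mul_continuous.
  case: (e \in L) => x; first exact: cp.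
  by apply: cvgB; [exact: cvg_cst | exact: cp].
apply: (@continuous_big R _ +%R 0 (fun L : {set V * V} => L \subset E) _ X) => [|L _].
  exact: add_continuous.
by move=> x; apply: cvgMr_tmp; exact: cprob.
Qed.

Lemma ratio_continuous (X : topologicalType) (p : X -> V * V -> R) S T x :
    (forall e, continuous (p^~ e)) -> spread E (p x) T != 0 ->
  {for x, continuous (fun y => spread E (p y) S / spread E (p y) T)}.
Proof.
move=> cp T0; apply: cvgM; first exact: spread_continuous.
by apply: cvgV => //; exact: spread_continuous.
Qed.

Lemma robust_ratio_min (k : nat) l r S : (1 <= k <= #|V|)%N ->
    (forall e, e \in E -> [/\ 0 <= l e, l e <= r e & r e <= 1]) ->
  ratios E k l r S (robust_ratio E k l r S) /\
  lbound (ratios E k l r S) (robust_ratio E k l r S).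
Proof.
case/andP=> k0 kV hlr.
pose u e := if e \in E then r e else l e.
pose A : set (prod_topology (fun _ : V * V => R)) :=
  [set f | forall e, `[l e, u e]%classic (f e)]%classic.
pose h T (theta : prod_topology (fun _ : V * V => R)) :=
  spread E theta S / spread E theta T.
have Abox f : A f -> param_space E l r f.
  by move=> Af e eE; have := Af e; rewrite /= in_itv /= /u eE.
have par f : param_space E l r f -> is_param f.
  move=> Bf e eE; have [l0 _ r1] := hlr e eE; have /andP[lf fr] := Bf e eE.
  by rewrite (le_trans l0 lf) (le_trans fr r1).
have pos f T : param_space E l r f -> #|T| = k -> 0 < spread E f T.
  move=> /par pf Tk; apply: lt_le_trans (spread_ge_card T pf).
  by rewrite Tk ltr0n.
have A0 : (A !=set0)%classic.
  exists l => e; rewrite /= in_itv /= lexx /u.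
  by case: ifP => [/hlr[]|_]; rewrite ?lexx.
have Aco : compact A.
  apply: (@tychonoff _ (fun=> R) (fun e => `[l e, u e]%classic)) => e.
  exact: segment_compact.
have [c hc] : {c : {set V} -> prod_topology (fun _ : V * V => R) & forall T,
    #|T| = k -> A (c T) /\ forall t, A t -> h T (c T) <= h T t}.
  apply: (@choice _ _ (fun T (cT : prod_topology (fun _ : V * V => R)) =>
    #|T| = k -> A cT /\ forall t, A t -> h T cT <= h T t)) => T.
  have [Tk|] := pselect (#|T| = k); last by exists l.
  have [|cT cTA cTmin] := @compact_EVT_min _ _ (h T) A A0 Aco.
    apply: continuous_in_subspaceT => th; rewrite inE => thA.
    apply: ratio_continuous => [e|]; first exact: (@proj_continuous _ (fun=> R) e).
    by rewrite gt_eqF // pos //; exact: Abox.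
  exists cT => _; split; first by rewrite inE in cTA.
  by move=> t tA; apply: cTmin; rewrite inE.
have [S0 [S0k _]] := optimal_seed_exists l kV.
have S0k' : #|S0| == k by apply/eqP.
case: (@arg_minP _ _ _ S0 (fun T : {set V} => #|T| == k) (fun T => h T (c T)) S0k').
move=> T0 /eqP T0k T0min; have [cT0 _] := hc T0 T0k.
have [So [Sok Somax]] := optimal_seed_exists (c T0) kV.
have leh : h So (c T0) <= h T0 (c T0).
  rewrite /h; apply: ler_wpM2l.
    by apply: le_trans (spread_ge_card S (par _ (Abox _ cT0))); rewrite ler0n.
  by rewrite lef_pV2 ?posrE ?pos //; [exact: Somax|exact: Abox|exact: Abox].
have inx : ratios E k l r S (h So (c T0)).
  by exists (c T0), So; split => //; exact: Abox.
have lbx : lbound (ratios E k l r S) (h So (c T0)).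
  move=> x [theta [T [Bt [Tk _] ->]]].
  pose theta' : prod_topology (fun _ : V * V => R) :=
    fun e => if e \in E then theta e else l e.
  have At : A theta'.
    move=> e; rewrite /= in_itv /= /theta' /u.
    by case: ifP => [/Bt|]; rewrite ?lexx.
  have eqE : {in E, theta =1 theta'} by move=> e eE; rewrite /theta' eE.
  rewrite (spread_ext S eqE) (spread_ext T eqE) -/(h T theta').
  apply: le_trans leh _; apply: le_trans (T0min T _) _; first exact/eqP.
  by have [_] := hc T Tk; apply.
suff -> : robust_ratio E k l r S = h So (c T0) by [].
apply/eqP; rewrite eq_le; apply/andP; split.
  by apply: ge_inf => //; exists (h So (c T0)).
by apply: lb_le_inf => //; exists (h So (c T0)).
Qed.

End RobustRatioMin.

(* Main.v *)
(** The spread is monotone and submodular in the seed set, so each greedy step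
    closes at least a fraction [1/k] of the gap to any competitor of size [k],
    whence the factor [1 - (1 - 1/k)^k >= 1 - 1/e].  Raising edge probabilities
    only raises the spread: for [theta] in the box with optimal seed set [T],
    the output [S] of LUGreedy satisfies [spread theta S >= spread l S], while
    [spread theta T <= spread r T <= spread r Sp / (1 - 1/e)].  The quotient of
    these bounds does not depend on [theta]. *)
Require Import Defs.
From HB Require Import structures.
From mathcomp Require Import all_boot all_order all_algebra.
From mathcomp Require Import all_classical all_reals all_analysis.
From mathcomp Require Import fintype finset lra.
Import Order.TTheory GRing.Theory Num.Theory.
Local Open Scope ring_scope.

(** * Monotonicity of live-edge expectations in the edge probabilities *)

Section LiveEdgeExpectation.
Context {R : realType} {V : finType}.
Implicit Types (E L : {set V * V}) (theta : V * V -> R) (f : {set V * V} -> R).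

(** The function [f] is arbitrary so that an induction on edges can replace it by
    [fun L => f (e |: L)]. *)
Definition live_expect E theta f : R :=
  \sum_(L : {set V * V} | L \subset E) live_prob E theta L * f L.

Lemma live_prob_setD1 E theta L e : e \in E -> live_prob E theta L =
  (if e \in L then theta e else 1 - theta e) * live_prob (E :\ e) theta L.
Proof.
by move=> eE; rewrite /live_prob (big_setD1 e eE).
Qed.

Lemma live_prob_setU1 E theta L e : e \notin E ->
  live_prob E theta (e |: L) = live_prob E theta L.
Proof.
move=> eE; apply: eq_bigr => d dE; rewrite in_setU1.
by rewrite (negPf (memPn eE d dE)).
Qed.

(** Condition on whether [e] is live: adding [e] is a bijection from the subsets of [E :\ e] to the
    subsets of [E] that contain [e]. *)
Lemma live_expect_setD1 E theta f e : e \in E -> live_expect E theta f =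
  theta e * live_expect (E :\ e) theta (fun L => f (e |: L))
  + (1 - theta e) * live_expect (E :\ e) theta f.
Proof.
move=> eE; rewrite /live_expect (bigID (fun L : {set V * V} => e \in L)) /=.
rewrite !big_distrr /=; congr (_ + _).
  rewrite (reindex_onto (fun L => e |: L) (fun L => L :\ e)) /=; last first.
    by move=> L /andP[_ eL]; rewrite setD1K.
  apply: eq_big => [L|L /andP[_ /eqP eL]].
    rewrite setU11 andbT subUset sub1set eE /= subsetD1; congr (_ && _).
    apply/eqP/idP => [<-|eL]; first by rewrite !inE eqxx.
    by rewrite setU1K.
  rewrite (live_prob_setD1 _ _ _ _ eE) setU11 live_prob_setU1 ?mulrA //.
  by rewrite !inE eqxx.
apply: eq_big => [L|L /andP[_ eL]]; first by rewrite subsetD1.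
by rewrite (live_prob_setD1 _ _ _ _ eE) (negPf eL) mulrA.
Qed.

Lemma ler_live_expect E theta f g : is_param E theta ->
    (forall L, f L <= g L) -> live_expect E theta f <= live_expect E theta g.
Proof.
by move=> pt fg; apply: ler_sum => L _; apply: ler_wpM2l; rewrite ?live_prob_ge0.
Qed.

(** Induction on the number of edges, conditioning on one edge at a time. The expectation is affine
    in the probability of that edge, with slope nonnegative because a live edge can only increase
    [f]. *)
Lemma live_expect_homo E theta theta' f :
    (forall e, e \in E -> [/\ 0 <= theta e, theta e <= theta' e & theta' e <= 1]) ->
    {homo f : L L' / L \subset L' >-> L <= L'} ->
  live_expect E theta f <= live_expect E theta' f.
Proof.
have [n] := ubnP #|E|; elim: n E f => // n IH E f En hth fmono.
have [->|/set0Pn[e eE]] := eqVneq E set0.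
  rewrite /live_expect le_eqVlt; apply/orP; left; apply/eqP.
  by apply: eq_bigr => L _; rewrite /live_prob !big_set0.
rewrite !(live_expect_setD1 _ _ _ _ eE).
have En' : (#|E :\ e| < n)%N by rewrite (cardsD1 e E) eE in En.
have hth' d : d \in E :\ e ->
    [/\ 0 <= theta d, theta d <= theta' d & theta' d <= 1].
  by move=> /setD1P[_ /hth].
have pt' : is_param (E :\ e) theta'.
  by move=> d /hth'[h0 h1 ->]; rewrite (le_trans h0 h1).
have ha := IH _ (fun L => f (e |: L)) En' hth'
  (fun L L' sLL' => fmono _ _ (setUS _ sLL')).
have hb := IH _ f En' hth' fmono.
have hab := ler_live_expect _ _ f (fun L => f (e |: L)) pt'
  (fun L => fmono _ _ (subsetUr _ _)).
have [t0 tt' t1] := hth e eE.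
move: ha hb hab; set a := live_expect _ _ _; set a' := live_expect _ theta' _.
set b := live_expect _ _ _; set b' := live_expect _ _ _ => ha hb hab.
have h1 : theta e * a <= theta e * a' by apply: ler_wpM2l.
have h2 : (1 - theta e) * b <= (1 - theta e) * b'.
  by apply: ler_wpM2l => //; rewrite subr_ge0 (le_trans tt').
(* This is the gain from moving weight [theta' e - theta e] from the case [e] dead to the case [e]
   live. *)
have h3 : 0 <= (theta' e - theta e) * (a' - b') by rewrite mulr_ge0 ?subr_ge0.
lra.
Qed.

End LiveEdgeExpectation.

(** * Reachability as a coverage function of the seeds *)

Section Reachability.
Context {V : finType}.
Implicit Types (L : {set V * V}) (S T : {set V}).

Lemma reach_homo_edges L L' S : L \subset L' -> reach L S \subset reach L' S.
Proof.
move=> sLL'; apply/subsetP => v; rewrite !inE => /exists_inP[u uS uv].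
apply/exists_inP; exists u => //; apply: connect_sub uv => x y xy.
by apply: connect1; exact: (subsetP sLL').
Qed.

Lemma reach_homo_seeds L S T : S \subset T -> reach L S \subset reach L T.
Proof.
move=> sST; apply/subsetP => v; rewrite !inE => /exists_inP[u uS uv].
by apply/exists_inP; exists u => //; exact: (subsetP sST).
Qed.

Lemma reach_set0 L : reach L set0 = set0.
Proof.
apply/setP => v; rewrite !inE; apply/exists_inP => -[u].
by rewrite inE.
Qed.

(** Submodularity in the form used by greedy. A path starts at a single seed, so each node not
    reached from [S] is newly reached from some [t] in [T]; a union bound finishes. The truncated
    subtraction is exact, since [reach L S] is contained in [reach L (t |: S)]. *)
Lemma card_reachU L S T : (#|reach L (T :|: S)| <= #|reach L S|
  + \sum_(t in T) (#|reach L (t |: S)| - #|reach L S|))%N.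
Proof.
have cardD t : (#|reach L (t |: S)| - #|reach L S|)%N =
    #|reach L (t |: S) :\: reach L S|.
  by rewrite cardsDS // reach_homo_seeds // subsetUr.
under eq_bigr do rewrite cardD.
apply: leq_trans (_ : (#|reach L S :|:
    \bigcup_(t in T) (reach L (t |: S) :\: reach L S)| <= _)%N).
  apply/subset_leq_card/subsetP => v vTS; rewrite in_setU.
  have [//|/= vS] := boolP (v \in reach L S).
  move: vTS; rewrite inE => /exists_inP[u]; rewrite inE => /orP[uT|uS] uv.
    apply/bigcupP; exists u => //; rewrite in_setD vS inE.
    by apply/exists_inP; exists u; rewrite ?setU11.
  by case/negP: vS; rewrite inE; apply/exists_inP; exists u.
rewrite cardsU (leq_trans (leq_subr _ _)) // leq_add2l.
elim/big_rec2 : _ => [|t n A _ An]; first by rewrite cards0.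
by rewrite cardsU (leq_trans (leq_subr _ _)) // leq_add2l.
Qed.

End Reachability.

(** * Averaging over live-edge graphs *)

Section Spread.
Context {R : realType} {V : finType} {E : {set V * V}}.
Implicit Types (theta l r : V * V -> R) (S T : {set V}).

Lemma spread_homo_param l r S :
    (forall e, e \in E -> [/\ 0 <= l e, l e <= r e & r e <= 1]) ->
  spread E l S <= spread E r S.
Proof.
move=> hlr; apply: (live_expect_homo _ _ _ (fun L => #|reach L S|%:R) hlr).
by move=> L L' sLL'; rewrite ler_nat subset_leq_card ?reach_homo_edges.
Qed.

Lemma spread_homo_seeds theta S T : is_param E theta -> S \subset T ->
  spread E theta S <= spread E theta T.
Proof.
move=> pt sST; apply: (ler_live_expect _ _ _ _ pt) => L.
by rewrite ler_nat subset_leq_card ?reach_homo_seeds.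
Qed.

Lemma spread_set0 theta : spread E theta set0 = 0.
Proof. by apply: big1 => L _; rewrite reach_set0 cards0 mulr0. Qed.

Lemma spreadU_le theta S T : is_param E theta -> spread E theta (T :|: S) <=
  spread E theta S + \sum_(t in T) (spread E theta (t |: S) - spread E theta S).
Proof.
move=> pt; rewrite /spread.
under [X in _ + X]eq_bigr do rewrite -sumrB.
rewrite exchange_big -big_split /=; apply: ler_sum => L _.
under [X in _ + X]eq_bigr do rewrite -mulrBr.
rewrite -mulr_sumr -mulrDr; apply: ler_wpM2l; first exact: live_prob_ge0.
apply: le_trans (_ : (#|reach L S| + \sum_(t in T)
  (#|reach L (t |: S)| - #|reach L S|))%N%:R <= _); first by rewrite ler_nat card_reachU.
rewrite natrD natr_sum lerD2l; apply: ler_sum => t _.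
by rewrite natrB // subset_leq_card ?reach_homo_seeds ?subsetUr.
Qed.

End Spread.

(** * The approximation guarantee of greedy *)

Section Greedy.
Context {R : realType} {V : finType} {E : {set V * V}}.
Implicit Types (theta : V * V -> R) (S T : {set V}).

Lemma card_greedy theta i S : greedy E theta i S -> #|S| = i.
Proof. by elim=> [|{}i {}S v _ <- vS _]; rewrite ?cards0 // cardsU1 vS. Qed.

Lemma greedy_exists theta i : (i <= #|V|)%N -> exists S, greedy E theta i S.
Proof.
elim: i => [|i IH] iV; first by exists set0; exact: greedy_start.
have [S gS] := IH (ltnW iV).
have /set0Pn[v0 v0S] : ~: S != set0.
  by rewrite -card_gt0 cardsCs setCK (card_greedy _ _ _ gS) subn_gt0.
rewrite inE in v0S.
case: (@arg_maxP _ _ _ v0 (fun v => v \notin S)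
  (fun v => spread E theta (v |: S) - spread E theta S) v0S) => v vS vmax.
by exists (v |: S); apply: greedy_step.
Qed.

(** The size [k] of the competitor is kept apart from the step count [i], which drives the
    induction. *)
Lemma greedy_gap theta k i S T : is_param E theta -> (0 < k)%N -> #|T| = k ->
    greedy E theta i S ->
  spread E theta T - spread E theta S <= (1 - k%:R^-1) ^+ i * spread E theta T.
Proof.
move=> pt k0 Tk; elim=> [|{}i {}S v _ IH vS vmax].
  by rewrite spread_set0 subr0 mul1r.
set F := spread E theta in IH vmax *.
have gain : F T - F S <= k%:R * (F (v |: S) - F S).
  have h1 : F T <= F (T :|: S) by apply: spread_homo_seeds; rewrite ?subsetUl.
  have h2 : \sum_(t in T) (F (t |: S) - F S) <= \sum_(t in T) (F (v |: S) - F S).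
    (* The greedy choice only compares nodes outside [S]; a node already in [S] gains zero, which
       monotonicity bounds by the gain of [v]. *)
    apply: ler_sum => t _; have [tS|/vmax//] := boolP (t \in S).
    rewrite (setUidPr _) ?sub1set // subrr subr_ge0.
    by apply: spread_homo_seeds; rewrite ?subsetUr.
  rewrite sumr_const Tk -mulr_natl in h2.
  by rewrite lerBlDl; apply: le_trans h1 (le_trans (spreadU_le _ _ _ pt) _); rewrite lerD2l.
have kR : 0 < k%:R :> R by rewrite ltr0n.
have k1 : k%:R^-1 <= 1 :> R by rewrite invf_le1 // ler1n.
(* Now the gap after adding [v] is at most [1 - k%:R^-1] times the gap before, and this factor is
   nonnegative, so the induction hypothesis can be scaled by it. *)
rewrite -ler_pdivrMl // in gain.
rewrite exprS -mulrA; apply: le_trans (ler_wpM2l _ IH); last by rewrite subr_ge0.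
lra.
Qed.

(** Take [1 + x <= expR x] at [x = - k%:R^-1] and raise both nonnegative sides to the power [k]. *)
Lemma expr_le_inv_expR k : (0 < k)%N -> (1 - k%:R^-1) ^+ k <= (expR 1)^-1 :> R.
Proof.
move=> k0; have kR : 0 < k%:R :> R by rewrite ltr0n.
have -> : (expR 1)^-1 = expR (- k%:R^-1) ^+ k :> R.
  by rewrite -expRM_natl mulrN mulfV ?gt_eqF // expRN.
apply: lerXn2r; rewrite ?nnegrE ?expR_ge0 ?expR_ge1Dx //.
by rewrite subr_ge0 invf_le1 // ler1n.
Qed.

Lemma greedy_approx theta k S T : is_param E theta -> (0 < k)%N -> #|T| = k ->
    greedy E theta k S ->
  (1 - 1 / expR 1) * spread E theta T <= spread E theta S.
Proof.
move=> pt k0 Tk gS; rewrite mul1r mulrBl mul1r lerBlDr -lerBlDl.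
apply: le_trans (greedy_gap _ _ _ _ _ pt k0 Tk gS) _; apply: ler_wpM2r.
  by apply: le_trans (spread_ge_card T pt); rewrite ler0n.
exact: expr_le_inv_expR.
Qed.

End Greedy.

Theorem theorem2 (R : realType) (V : finType) (E : {set V * V}) (k : nat)
    (l r : V * V -> R)
    (hk : (1 <= k <= #|V|)%N)
    (hlr : forall e, e \in E -> [/\ 0 <= l e, l e <= r e & r e <= 1]) :
  (exists Sm Sp S : {set V}, lu_greedy E k l r Sm Sp S) /\
  (forall Sm Sp S : {set V}, lu_greedy E k l r Sm Sp S ->
     #|S| = k /\
     robust_ratio E k l r S >= alpha E l r S Sp * (1 - 1 / expR 1)).
Proof.
have /andP[k0 kV] := hk; split.
  have [Sm gm] := greedy_exists (E := E) l k kV.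
  have [Sp gp] := greedy_exists (E := E) r k kV.
  exists Sm, Sp; have [h|/ltW h] := leP (spread E l Sm) (spread E l Sp).
    by exists Sp; split => //; right.
  by exists Sm; split => //; left.
move=> Sm Sp S [gm gp SmSp _]; have Sk : #|S| = k.
  by case: SmSp => ->; [exact: card_greedy _ _ _ gm | exact: card_greedy _ _ _ gp].
split => //.
(* The infimum is attained, so it suffices to bound the ratio at one [theta] with one optimal set
   [T]. *)
have [[theta [T [Bt [Tk _] ->]]] _] := robust_ratio_min S hk hlr.
have lo e : e \in E -> [/\ 0 <= l e, l e <= theta e & theta e <= 1].
  move=> eE; have [l0 _ r1] := hlr e eE; have /andP[lt tr] := Bt e eE.
  by split => //; exact: le_trans r1.
have hi e : e \in E -> [/\ 0 <= theta e, theta e <= r e & r e <= 1].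
  move=> eE; have [l0 _ r1] := hlr e eE; have /andP[lt tr] := Bt e eE.
  by split => //; exact: le_trans lt.
have pt : is_param E theta by move=> e /hi[-> h1 h2]; rewrite (le_trans h1).
have pr : is_param E r by move=> e /hi[h0 h1 ->]; rewrite (le_trans h0 h1).
have pl : is_param E l by move=> e /lo[-> h1 h2]; rewrite (le_trans h1).
have pos (th : V * V -> R) (A : {set V}) : is_param E th -> #|A| = k -> 0 < spread E th A.
  by move=> pth Ak; apply: lt_le_trans (spread_ge_card A pth); rewrite Ak ltr0n.
have T0 := pos _ _ pt Tk; have p0 := pos _ _ pr (card_greedy _ _ _ gp).
(* Both denominators are positive, since a set of size [k] has spread at least [k]; clear them. *)
rewrite /alpha mulrAC ler_pdivrMr // mulrAC ler_pdivlMr // -mulrA.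
apply: le_trans (_ : spread E l S * spread E r Sp <= _); last first.
  by apply: ler_wpM2r; [exact: ltW | exact: spread_homo_param].
apply: ler_wpM2l.
  by apply: le_trans (spread_ge_card S pl); rewrite ler0n.
(* [T] is optimal for [theta], not necessarily for [r], but greedy at [r] competes with every set of
   size [k]. *)
apply: le_trans (greedy_approx _ _ _ _ pr k0 Tk gp) => //.
apply: ler_wpM2l; last exact: spread_homo_param.
by rewrite mul1r subr_ge0 invf_le1 ?expR_gt0 // -expR0 ler_expR.
Qed.
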